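(* Let $\rho$ and $\widetilde{\rho}$ be any two states on $\mathcal{H}_{AB}=\mathcal{H}_A\otimes\mathcal{H}_B$, let $\epsilon=\|\rho-\widetilde{\rho}\|_1$ (with $\epsilon\le 1$), and let $d_A=\dim\mathcal{H}_A$. Then $$|K^{(1)}_{\rightarrow}(\rho)-K^{(1)}_{\rightarrow}(\widetilde{\rho})|\leq 8\epsilon\log d_A+4\eta(1-\epsilon)+4\eta(\epsilon).$$
   Context: Hilbert spaces are finite-dimensional; $\|\cdot\|_1$ is the trace norm; $\log$ is base $2$; $\eta(x)=-x\log x$ for $0<x\le 1$ and $\eta(0)=0$. For a state $\rho$ on $\mathcal{H}_A\otimes\mathcal{H}_B$ let $\rho_{ABE}$ be a purification of $\rho$, with $E$ the eavesdropper's system. The one-copy one-way secret key quantity is $$K^{(1)}_{\rightarrow}(\rho)=\max_{Q,\,T|X}\big[I(X:B|T)-I(X:E|T)\big],$$ where the maximum is over all POVMs $Q=(Q_x)_{x\in\mathcal{X}}$ on $\mathcal{H}_A$ and all classical channels $R$ with $T=R(X)$ (one may assume $|\mathcal{X}|\le d_A^2$ and $|T|\le d_A^2$), and the conditional quantum mutual informations are evaluated on the state $$\omega_{TXBE}=\sum_{t,x}R(t|x)\,|t\rangle\langle t|_T\otimes|x\rangle\langle x|_X\otimes\mathrm{Tr}_A\big(\rho_{ABE}(Q_x\otimes I_{BE})\big).$$ Here $I(X:Y|T)=S(XT)+S(YT)-S(XYT)-S(T)$ with $S$ the von Neumann entropy. *)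

(* Defs.v *)
From mathcomp Require Import all_boot all_order all_algebra.
From mathcomp Require Import spectral sesquilinear.
From mathcomp Require Import mxtens complex.
From mathcomp Require Import boolp classical_sets reals exp.

Set Implicit Arguments.
Unset Strict Implicit.
Unset Printing Implicit Defensive.

Import Order.TTheory GRing.Theory Num.Theory.

Local Open Scope ring_scope.
Local Open Scope complex_scope.
Local Open Scope sesquilinear_scope.
Local Open Scope classical_set_scope.

(* A Hilbert space of dimension n is C^n with its standard basis; operators are
   matrices, and H_1 (x) H_2 has the basis indexed by mxtens_index (i, j),
   the convention of tensmx ( *t ).  Multiple tensor products associate to the
   right.  M ^t* is the adjoint of M. *)

Section RealFunctions.
Variable R : realType.

Definition log2 (x : R) : R := ln x / ln 2.

(* log2 0 is a conventional value here, and eta 0 = 0. *)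
Definition eta (x : R) : R := - (x * log2 x).

End RealFunctions.

Section TensorProducts.
Variable K : pzRingType.

(* Tr_2 : L(H_1 (x) H_2) -> L(H_1) *)
Definition ptrace2 (m n : nat) (M : 'M[K]_(m * n)) : 'M[K]_m :=
  \matrix_(i, j) \sum_(k < n) M (mxtens_index (i, k)) (mxtens_index (j, k)).

(* Tr_1 : L(H_1 (x) H_2) -> L(H_2) *)
Definition ptrace1 (m n : nat) (M : 'M[K]_(m * n)) : 'M[K]_n :=
  \matrix_(i, j) \sum_(k < m) M (mxtens_index (k, i)) (mxtens_index (k, j)).

(* (id (x) Phi)(M): Phi applied to each block of M. *)
Definition idtens (m n p : nat) (Phi : 'M[K]_n -> 'M[K]_p) (M : 'M[K]_(m * n)) :
    'M[K]_(m * p) :=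
  \matrix_(i, j)
    Phi (\matrix_(k, l) M (mxtens_index ((mxtens_unindex i).1, k))
                          (mxtens_index ((mxtens_unindex j).1, l)))
      (mxtens_unindex i).2 (mxtens_unindex j).2.

End TensorProducts.

Section Quantum.
Variable R : realType.
Local Notation C := R[i].

(* 0 <= z in C means that z is real and nonnegative; over C this makes M
   Hermitian. *)
Definition psd (n : nat) (M : 'M[C]_n) : Prop :=
  forall v : 'cV[C]_n, 0 <= (v ^t* *m M *m v) 0 0.

Definition state (n : nat) (rho : 'M[C]_n) : Prop :=
  psd rho /\ \tr rho = 1.

(* The trace norm: the sum of the singular values, which are the square roots
   of the eigenvalues of M^* M. *)
Definition trace_norm (m n : nat) (M : 'M[C]_(m, n)) : R :=
  \sum_(i < n) Num.sqrt (complex.Re (spectral_diag (M ^t* *m M) 0 i)).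

(* S(rho) = - Tr (rho log rho); spectral_diag lists the eigenvalues of a normal
   matrix with their multiplicities. *)
Definition entropy (n : nat) (rho : 'M[C]_n) : R :=
  \sum_(i < n) eta (complex.Re (spectral_diag rho 0 i)).

(* I(X:Y|T) = S(XT) + S(YT) - S(XYT) - S(T) for w on T (x) X (x) Y *)
Definition cond_mutual_info (t x y : nat) (w : 'M[C]_(t * (x * y))) : R :=
  entropy (idtens (@ptrace2 C x y) w) + entropy (idtens (@ptrace1 C x y) w)
  - entropy w - entropy (ptrace2 w).

Definition purification (dA dB dE : nat) (rho : 'M[C]_(dA * dB))
    (rhoABE : 'M[C]_(dA * (dB * dE))) : Prop :=
  (exists psi : 'cV[C]_(dA * (dB * dE)), rhoABE = psi *m psi ^t*) /\
  idtens (@ptrace2 C dB dE) rhoABE = rho.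

Definition povm (dA nX : nat) (Q : 'I_nX -> 'M[C]_dA) : Prop :=
  (forall x, psd (Q x)) /\ \sum_x Q x = 1%:M.

(* r t x is the transition probability R(t|x). *)
Definition channel (nX nT : nat) (r : 'I_nT -> 'I_nX -> R) : Prop :=
  (forall t x, 0 <= r t x) /\ (forall x, \sum_t r t x = 1).

Definition omega (dA dB dE nX nT : nat) (rhoABE : 'M[C]_(dA * (dB * dE)))
    (Q : 'I_nX -> 'M[C]_dA) (r : 'I_nT -> 'I_nX -> R) :
    'M[C]_(nT * (nX * (dB * dE))) :=
  \sum_t \sum_x (r t x)%:C *:
    (delta_mx t t *t (delta_mx x x *t ptrace1 (rhoABE *m (Q x *t 1%:M)))).

Definition key_rate (dA dB dE nX nT : nat) (rhoABE : 'M[C]_(dA * (dB * dE)))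
    (Q : 'I_nX -> 'M[C]_dA) (r : 'I_nT -> 'I_nX -> R) : R :=
  let w := omega rhoABE Q r in
  cond_mutual_info (idtens (idtens (@ptrace2 C dB dE)) w)
  - cond_mutual_info (idtens (idtens (@ptrace1 C dB dE)) w).

(* K^(1) of rho_AB, computed from a given purification rho_ABE; two purifications
   of rho_AB give the same value.  The maximum over POVMs and channels ranges
   over all finite alphabets, so it is written as a supremum; the set is nonempty
   and bounded for every purification of a state. *)
Definition K1 (dA dB dE : nat) (rhoABE : 'M[C]_(dA * (dB * dE))) : R :=
  sup [set v | exists (nX nT : nat) (Q : 'I_nX -> 'M[C]_dA)
                      (r : 'I_nT -> 'I_nX -> R),
                 [/\ povm Q, channel r & v = key_rate rhoABE Q r]].

End Quantum.

(* Main.v *)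
(** For a bipartite positive operator M on AB put f(M) = S(AB) - S(B), without normalisation.
    If Q = X X^* then X^* psi is pure on ABE, so the entropies of its marginals on B and E
    differ by f of the operator (X^* (x) 1) rho (X (x) 1) on AB.  Since the coarse-grained
    effects Q_t = sum_x R(t|x) Q_x again form a POVM, the key rate is a difference of two
    functionals F(rho) = sum_i f((X_i^* (x) 1) rho (X_i (x) 1)) with sum_i X_i X_i^* = 1, one
    for the effects R(t|x) Q_x and one for the Q_t; neither involves E.

    Each F is homogeneous, bounded by log d_A times the trace, and additive up to
    delta = eta(a) + eta(b) - eta(a + b) for summands of traces a and b.  The last property
    needs no strong subadditivity: for the entropies of AB and of B separately the defect
    S(M + N) - S(M) - S(N) lies in [-delta, 0].  With the Alicki-Fannes interpolation this
    gives |F(rho) - F(rho')| <= 4 eps log d_A + 2 eta(eps) + 2 eta(1 - eps). *)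

Require Import Defs.
From mathcomp Require Import all_boot all_order all_algebra.
From mathcomp Require Import complex reals.
From mathcomp Require Import spectral sesquilinear mxtens boolp exp.
From mathcomp Require Import ring lra.

Set Implicit Arguments.
Unset Strict Implicit.
Unset Printing Implicit Defensive.

Import Order.TTheory GRing.Theory Num.Theory.
Local Open Scope ring_scope.
Local Open Scope complex_scope.
Local Open Scope sesquilinear_scope.

(** * The function eta *)

Section Eta.
Variable R : realType.
Implicit Types x y a b p q c : R.

Lemma eq_ler x y : x = y -> x <= y.
Proof. by move->. Qed.

Lemma ln2_gt0 : 0 < ln (2 : R).
Proof. by apply: ln_gt0; rewrite ltr1n. Qed.

Lemma log2M x y : 0 < x -> 0 < y -> log2 (x * y) = log2 x + log2 y.
Proof. by move=> x0 y0; rewrite /log2 lnM // mulrDl. Qed.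

Lemma log2V x : 0 < x -> log2 x^-1 = - log2 x.
Proof. by move=> x0; rewrite /log2 lnV // mulNr. Qed.

Lemma eta0 : eta (0 : R) = 0.
Proof. by rewrite /eta mul0r oppr0. Qed.

Lemma eta1 : eta (1 : R) = 0.
Proof. by rewrite /eta /log2 ln1 mul0r mulr0 oppr0. Qed.

Lemma etaM c x : 0 <= c -> 0 <= x -> eta (c * x) = c * eta x + x * eta c.
Proof.
rewrite !le_eqVlt => /predU1P[<- _|c0]; first by rewrite !(mul0r, eta0, mulr0) addr0.
case/predU1P=> [<-|x0]; first by rewrite !(mul0r, eta0, mulr0) addr0.
by rewrite /eta log2M //; ring.
Qed.

(** The right-hand side is the tangent of [eta] at [y]; for positive [x] the bound is
    [ln u <= u - 1] at [u = y / x]. *)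
Lemma eta_le_tangent x y : 0 <= x -> 0 < y ->
  eta x <= - (x * log2 y) + (y - x) / ln 2.
Proof.
rewrite le_eqVlt => /predU1P[<- y0|x0 y0].
  by rewrite eta0 mul0r oppr0 add0r addr0 divr_ge0 // ltW // ln2_gt0.
rewrite /eta /log2 !mulrA -!mulNr -mulrDl ler_pM2r ?invr_gt0 ?ln2_gt0 //.
have : ln (y / x) <= y / x - 1.
  rewrite -[X in ln X](addrNK 1) addrC; apply: le_ln1Dx.
  by rewrite ltrBrDl subrr divr_gt0.
rewrite ln_div ?posrE // => /(ler_wpM2l (ltW x0)) h.
have e : x * (y / x) = y by rewrite mulrC divfK ?gt_eqF.
by move: h; rewrite mulrBr mulrDr e; lra.
Qed.

Lemma eta_jensen (I : finType) (w x : I -> R) :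
  (forall i, 0 <= w i) -> \sum_i w i = 1 -> (forall i, 0 <= x i) ->
  \sum_i w i * eta (x i) <= eta (\sum_i w i * x i).
Proof.
move=> w0 w1 x0; set y := \sum_i w i * x i.
have y0 : 0 <= y by apply: sumr_ge0 => i _; rewrite mulr_ge0.
(* [eta] has no tangent at 0, but a zero mean forces every [w i * x i] to vanish. Otherwise the
   tangent bound at the mean [y] is averaged. *)
have [yE|yN0] := eqVneq y 0.
  have wx0 i : w i * x i = 0.
    by apply: (psumr_eq0P _ yE) => // j _; rewrite mulr_ge0.
  rewrite yE eta0 big1 // => i _; have /eqP := wx0 i.
  by rewrite mulf_eq0 => /orP[]/eqP->; rewrite ?eta0 ?mul0r ?mulr0.
have {yN0}y0 : 0 < y by rewrite lt_def yN0.
apply: (@le_trans _ _ (\sum_i (w i * x i * (- log2 y - (ln 2)^-1) + w i * (y / ln 2)))).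
  apply: ler_sum => i _; apply: le_trans (ler_wpM2l (w0 i) (eta_le_tangent (x0 i) y0)) _.
  by apply: eq_ler; ring.
rewrite big_split /= -!mulr_suml w1 -/y /eta; apply: eq_ler; ring.
Qed.

(** Jensen's inequality with uniform weights, rescaled by [etaM]: for a given total mass the uniform
    distribution has the largest entropy. *)
Lemma sum_eta_le (n : nat) (x : 'I_n -> R) : (forall i, 0 <= x i) ->
  \sum_i eta (x i) <= eta (\sum_i x i) + (\sum_i x i) * log2 n%:R.
Proof.
case: n x => [|n] x x0; first by rewrite !big_ord0 eta0 mul0r addr0.
have n0 : 0 < n.+1%:R :> R by rewrite ltr0n.
have n1 : n.+1%:R * n.+1%:R^-1 = 1 :> R by rewrite divff // gt_eqF.
have w1 : \sum_(i < n.+1) n.+1%:R^-1 = 1 :> R by rewrite sumr_const card_ord -[LHS]mulr_natl n1.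
have w0 : 0 <= n.+1%:R^-1 :> R by rewrite invr_ge0 ltW.
have := eta_jensen (fun=> w0) w1 x0; rewrite -!mulr_sumr.
have s0 : 0 <= \sum_i x i by apply: sumr_ge0.
rewrite (etaM w0 s0) => /(ler_wpM2l (ltW n0)).
rewrite mulrA n1 mul1r => /le_trans; apply; apply: eq_ler.
rewrite [eta n.+1%:R^-1]/eta log2V //.
by field; rewrite nat1r gt_eqF.
Qed.

Definition mixing_entropy a b : R := eta a + eta b - eta (a + b).

(** Gibbs' inequality for two outcomes: the tangents of [eta] at [(a + b) * p] and [(a + b) * q] are
    added, and their correction terms cancel because [p + q = 1]. The bound is linear in [a] and
    [b], so it can be summed. *)
Lemma mixing_entropy_le a b p q : 0 <= a -> 0 <= b -> 0 < p -> 0 < q -> p + q = 1 ->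
  mixing_entropy a b <= - (a * log2 p) - b * log2 q.
Proof.
move=> a0 b0 p0 q0 pq; rewrite /mixing_entropy.
have [ab|ab] := eqVneq (a + b) 0.
  have [-> ->] : a = 0 /\ b = 0 by lra.
  by rewrite addr0 eta0 !mul0r; lra.
have s0 : 0 < a + b by rewrite lt_def ab addr_ge0.
have := eta_le_tangent a0 (mulr_gt0 s0 p0); have := eta_le_tangent b0 (mulr_gt0 s0 q0).
have e : ((a + b) * p - a) / ln 2 + ((a + b) * q - b) / ln 2 = 0.
  have -> : q = 1 - p by lra.
  by ring.
by rewrite !log2M // [eta (a + b)]/eta; lra.
Qed.

(* mixing_entropy a b is a + b times the binary entropy of a / (a + b), which is concave. *)
Lemma sum_mixing_entropy_le (I : finType) (a b : I -> R) :
  (forall i, 0 <= a i) -> (forall i, 0 <= b i) ->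
  \sum_i mixing_entropy (a i) (b i) <= mixing_entropy (\sum_i a i) (\sum_i b i).
Proof.
move=> a0 b0; set s := \sum_i a i; set t := \sum_i b i.
have s0 : 0 <= s by apply: sumr_ge0.
have t0 : 0 <= t by apply: sumr_ge0.
have mix0l x : mixing_entropy 0 x = 0 by rewrite /mixing_entropy eta0 !add0r subrr.
have mix0r x : mixing_entropy x 0 = 0 by rewrite /mixing_entropy eta0 !addr0 subrr.
have [sE|sN0] := eqVneq s 0.
  rewrite sE mix0l big1 // => i _; rewrite (psumr_eq0P _ sE) ?mix0l //.
have [tE|tN0] := eqVneq t 0.
  rewrite tE mix0r big1 // => i _; rewrite (psumr_eq0P _ tE) ?mix0r //.
have {sN0}s0 : 0 < s by rewrite lt_def sN0.
have {tN0}t0 : 0 < t by rewrite lt_def tN0.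
have st0 : 0 < s + t by rewrite addr_gt0.
have pq : s / (s + t) + t / (s + t) = 1 by rewrite -mulrDl divff // gt_eqF.
apply: (@le_trans _ _ (\sum_i (- (a i * log2 (s / (s + t))) - b i * log2 (t / (s + t))))).
  by apply: ler_sum => i _; apply: mixing_entropy_le; rewrite ?divr_gt0.
rewrite big_split /= !sumrN -!mulr_suml -/s -/t !log2M ?invr_gt0 // !log2V //.
rewrite /mixing_entropy /eta; apply: eq_ler; ring.
Qed.

End Eta.

(** * Spectra and positive operators *)

Section CharPoly.

(** The determinant of one block matrix [P] is computed twice, by clearing the block [B'] and by
    clearing the block [A']. Hence [A *m B] and [B *m A] share their nonzero eigenvalues with
    multiplicities. *)
Lemma char_poly_mulmxC (K : idomainType) (m n : nat) (A : 'M[K]_(m, n)) (B : 'M[K]_(n, m)) :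
  char_poly (A *m B) * 'X^n = 'X^m * char_poly (B *m A).
Proof.
pose A' := map_mx polyC A; pose B' := map_mx polyC B.
pose P : 'M[{poly K}]_(m + n) := block_mx 'X%:M A' B' 1%:M.
have detL : \det P = char_poly (A *m B).
  rewrite /char_poly /char_poly_mx map_mxM /= -/A' -/B'.
  transitivity (\det (P *m block_mx 1%:M 0 (- B') 1%:M)).
    by rewrite det_mulmx det_lblock !det1 !mulr1.
  rewrite mulmx_block !mulmx1 !mulmx0 !mul1mx mulmxN addrN !add0r.
  by rewrite det_ublock det1 mulr1.
have detR : \det P * 'X^n = 'X^m * char_poly (B *m A).
  rewrite /char_poly /char_poly_mx map_mxM /= -/A' -/B'.
  transitivity (\det (P *m block_mx 1%:M (- A') 0 'X%:M)).
    by rewrite det_mulmx det_ublock det1 mul1r det_scalar.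
  rewrite mulmx_block !mulmx1 !mulmx0 !mul1mx !mulmxN !addr0.
  rewrite mul_scalar_mx mul_mx_scalar addNr.
  by rewrite det_lblock det_scalar addrC.
by rewrite -detL.
Qed.

Lemma char_poly_diag_mx (K : comNzRingType) (n : nat) (d : 'rV[K]_n) :
  char_poly (diag_mx d) = \prod_i ('X - (d 0 i)%:P).
Proof.
rewrite char_poly_trig ?diag_mx_is_trig //.
by apply: eq_bigr => i _; rewrite mxE eqxx mulr1n.
Qed.

(** By unique factorisation the two root lists, padded with zeros for the powers of ['X], are
    permutations of each other; [g 0 = 0] makes the padding invisible. *)
Lemma sum_roots_eq (K : fieldType) (V : zmodType) (g : K -> V) (s t : seq K) (a b : nat) :
  g 0 = 0 ->
  \prod_(x <- s) ('X - x%:P) * 'X^a = 'X^b * \prod_(x <- t) ('X - x%:P) ->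
  \sum_(x <- s) g x = \sum_(x <- t) g x.
Proof.
move=> g0.
have XnE k : 'X^k = \prod_(x <- nseq k (0 : K)) ('X - x%:P).
  by elim: k => [|k IHk]; rewrite /= ?big_nil // big_cons -IHk subr0 exprS.
rewrite !XnE -!big_cat => /prod_XsubC_eq st.
have : \sum_(x <- s ++ nseq a 0) g x = \sum_(x <- nseq b 0 ++ t) g x by exact: perm_big.
by rewrite !big_cat /= !big_nseq g0 !iter_addr_0 !mul0rn addr0 add0r.
Qed.

End CharPoly.

(** * Adjoints and spectral sums of Hermitian matrices *)

Section Adjoint.
Variable R : realType.
Local Notation C := R[i].

Lemma adjmxM (m n p : nat) (A : 'M[C]_(m, n)) (B : 'M[C]_(n, p)) :
  (A *m B)^t* = B^t* *m A^t*.
Proof. by rewrite trmx_mul map_mxM. Qed.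

Lemma adjmxB (m n : nat) (A B : 'M[C]_(m, n)) : (A - B)^t* = A^t* - B^t*.
Proof. by rewrite linearB /= map_mxB. Qed.

Lemma conjC_real (x : R) : Num.conj (x%:C : C) = x%:C.
Proof. exact: conjc_real. Qed.

Lemma adjmx1 (n : nat) : (1%:M : 'M[C]_n)^t* = 1%:M.
Proof. by rewrite trmx1 map_mx1. Qed.

Definition rdiag_mx (n : nat) (d : 'I_n -> R) : 'M[C]_n := diag_mx (\row_i (d i)%:C).

Lemma adj_rdiag_mx (n : nat) (d : 'I_n -> R) : (rdiag_mx d)^t* = rdiag_mx d.
Proof.
rewrite /rdiag_mx tr_diag_mx map_diag_mx; congr diag_mx.
by apply/rowP => i; rewrite !mxE /= conjC_real.
Qed.

Lemma mul_rdiag_mx (n : nat) (d d' : 'I_n -> R) :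
  rdiag_mx d *m rdiag_mx d' = rdiag_mx (fun i => d i * d' i).
Proof.
rewrite /rdiag_mx mulmx_diag; congr diag_mx.
by apply/rowP => i; rewrite !mxE rmorphM.
Qed.

Lemma ReD (x y : C) : complex.Re (x + y) = complex.Re x + complex.Re y.
Proof. by case: x y => ? ? []. Qed.

Lemma Re_sum (I : finType) (F : I -> C) : complex.Re (\sum_i F i) = \sum_i complex.Re (F i).
Proof. exact: (big_morph _ ReD). Qed.

Lemma ReZ (r : R) (x : C) : complex.Re (r%:C * x) = r * complex.Re x.
Proof. by case: x => ? ? /=; rewrite mul0r subr0. Qed.

Lemma Re_ge0 (x : C) : 0 <= x -> 0 <= complex.Re x.
Proof. by rewrite lecE => /andP[]. Qed.

Lemma hermitian_eigen (n : nat) (M : 'M[C]_n) : M^t* = M ->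
  exists (U : 'M[C]_n) (d : 'I_n -> R),
    [/\ U^t* *m U = 1%:M, U *m U^t* = 1%:M & M = U *m rdiag_mx d *m U^t*].
Proof.
move=> hM.
have Mh : M \is hermsymmx by apply/is_hermitianmxP; rewrite expr0 scale1r hM.
have /orthomx_spectralP eM := hermitian_normalmx Mh.
have Pu := spectral_unitarymx M; rewrite invmx_unitary // in eM.
exists ((spectralmx M)^t*), (fun i => complex.Re (spectral_diag M 0 i)).
rewrite trmxCK; split.
- exact/unitarymxP.
- by apply/mulmx1C/unitarymxP.
rewrite {1}eM; congr (_ *m diag_mx _ *m _); apply/rowP => i; rewrite !mxE RRe_real //.
by have /mxOverP := hermitian_spectral_diag_real Mh.
Qed.

Lemma char_poly_spectral (n : nat) (M : 'M[C]_n) : M^t* = M ->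
  char_poly M = \prod_i ('X - (spectral_diag M 0 i)%:P).
Proof.
move=> hM.
have Mh : M \is hermsymmx by apply/is_hermitianmxP; rewrite expr0 scale1r hM.
have /orthomx_spectralP eM := hermitian_normalmx Mh.
rewrite -char_poly_diag_mx {1}eM -mulmxA.
apply: (mulIf (monic_neq0 (monicXn C n))); rewrite char_poly_mulmxC mulrC.
by rewrite -mulmxA mulmxV ?mulmx1 // spectral_unit.
Qed.

(** Covers both spectral quantities in use: [g = eta] gives the entropy, and the square root applied
    to [H^t* *m H] gives the trace norm of [H]. *)
Definition spectral_sum (g : R -> R) (n : nat) (M : 'M[C]_n) : R :=
  \sum_i g (complex.Re (spectral_diag M 0 i)).

(** Characteristic polynomials compare spectra as multisets, whatever order [spectral_diag] uses;
    the powers of ['X] absorb the additional zero eigenvalues when the sizes differ. *)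
Lemma spectral_sum_char_poly (g : R -> R) (m n : nat) (M : 'M[C]_m) (d : 'I_n -> C) (a b : nat) :
  g 0 = 0 -> M^t* = M ->
  char_poly M * 'X^a = 'X^b * \prod_i ('X - (d i)%:P) ->
  spectral_sum g M = \sum_i g (complex.Re (d i)).
Proof.
move=> g0 hM; rewrite char_poly_spectral //.
pose s := [seq spectral_diag M 0 i | i <- index_enum 'I_m].
pose t := [seq d i | i <- index_enum 'I_n].
have := @sum_roots_eq C R (fun x => g (complex.Re x)) s t a b g0.
by rewrite !big_map.
Qed.

(** [X] is an isometry, possibly rectangular: directions outside its range carry the eigenvalue 0.
    Any convenient diagonalisation can thus replace [spectral_diag]. *)
Lemma spectral_sum_eigen (g : R -> R) (m n : nat) (M : 'M[C]_m) (X : 'M[C]_(m, n)) (d : 'I_n -> R) :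
  g 0 = 0 -> X^t* *m X = 1%:M -> M = X *m rdiag_mx d *m X^t* ->
  spectral_sum g M = \sum_i g (d i).
Proof.
move=> g0 X1 eM.
apply: (@spectral_sum_char_poly g m n M (fun i => (d i)%:C) n m g0).
  by rewrite eM !adjmxM trmxCK adj_rdiag_mx mulmxA.
rewrite eM -mulmxA char_poly_mulmxC -mulmxA X1 mulmx1 char_poly_diag_mx.
by congr (_ * _); apply: eq_bigr => i _; rewrite mxE.
Qed.

Lemma spectral_sum_mulmx_adj (g : R -> R) (m n : nat) (X : 'M[C]_(m, n)) : g 0 = 0 ->
  spectral_sum g (X *m X^t*) = spectral_sum g (X^t* *m X).
Proof.
move=> g0; apply: (@spectral_sum_char_poly g m n _ _ n m g0).
  by rewrite adjmxM trmxCK.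
by rewrite char_poly_mulmxC char_poly_spectral // adjmxM trmxCK.
Qed.

Lemma spectral_sum_tr (g : R -> R) (n : nat) (M : 'M[C]_n) : g 0 = 0 -> M^t* = M ->
  spectral_sum g M^T = spectral_sum g M.
Proof.
move=> g0 /hermitian_eigen[U [d [U1 U2 eM]]].
rewrite (spectral_sum_eigen g0 U1 eM).
have eX : ((U^t*)^T)^t* = U^T by apply/matrixP => i j; rewrite !mxE conjCK.
apply: (@spectral_sum_eigen g n n _ (U^t*)^T d g0); rewrite eX.
  by rewrite -trmx_mul U1 trmx1.
by rewrite eM !trmx_mul /rdiag_mx tr_diag_mx mulmxA.
Qed.

End Adjoint.

(** * Positive operators and their factorisations *)

Section Psd.
Variable R : realType.
Local Notation C := R[i].

Lemma psdD (n : nat) (A B : 'M[C]_n) : psd A -> psd B -> psd (A + B).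
Proof. by move=> pA pB v; rewrite mulmxDr mulmxDl mxE addr_ge0. Qed.

Lemma psdZ (n : nat) (x : R) (A : 'M[C]_n) : 0 <= x -> psd A -> psd (x%:C *: A).
Proof.
by move=> x0 pA v; rewrite -scalemxAr -scalemxAl mxE mulr_ge0 // ler0c.
Qed.

Lemma psd0 (n : nat) : psd (0 : 'M[C]_n).
Proof. by move=> v; rewrite mulmx0 mul0mx mxE. Qed.

Lemma psd_sum (I : finType) (n : nat) (F : I -> 'M[C]_n) :
  (forall i, psd (F i)) -> psd (\sum_i F i).
Proof. by move=> pF; elim/big_ind: _ => //; [exact: psd0|exact: psdD]. Qed.

Lemma psd_conj (m n : nat) (X : 'M[C]_(m, n)) (A : 'M[C]_n) :
  psd A -> psd (X *m A *m X^t*).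
Proof.
by move=> pA v; have := pA (X^t* *m v); rewrite adjmxM trmxCK !mulmxA.
Qed.

Lemma psd1 (n : nat) : psd (1%:M : 'M[C]_n).
Proof.
move=> v; rewrite mulmx1 !mxE sumr_ge0 // => i _.
by rewrite !mxE mulrC mul_conjC_ge0.
Qed.

Lemma psd_gram (m n : nat) (X : 'M[C]_(m, n)) : psd (X *m X^t*).
Proof. by rewrite -[X in X *m _]mulmx1; apply/psd_conj/psd1. Qed.

Lemma psd_diag_ge0 (n : nat) (A : 'M[C]_n) (i : 'I_n) : psd A -> 0 <= A i i.
Proof.
move=> /(_ (delta_mx i 0)).
by rewrite trmx_delta map_delta_mx -rowE -colE !mxE.
Qed.

Lemma psd_tr_ge0 (n : nat) (A : 'M[C]_n) : psd A -> 0 <= \tr A.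
Proof. by move=> pA; apply: sumr_ge0 => i _; apply: psd_diag_ge0. Qed.

(* N := i (M - M^* ) is Hermitian with vanishing quadratic form, so its eigenvalues vanish. *)
Lemma psd_herm (n : nat) (M : 'M[C]_n) : psd M -> M^t* = M.
Proof.
move=> pM; pose N := 'i%R *: (M - M^t*).
have hN : N^t* = N.
  apply/matrixP => i j; rewrite !mxE rmorphM rmorphB /= conjCi conjCK.
  by rewrite mulNr -mulrN opprB.
have [U [d [U1 U2 eN]]] := hermitian_eigen hN.
have d0 i : (d i)%:C = 0 :> C.
  have e : (U^t* *m N *m U) i i = 0.
    have := psd_diag_ge0 i (psd_conj (U^t*) pM); rewrite trmxCK => x0.
    have xR : Num.conj ((U^t* *m M *m U) i i) = (U^t* *m M *m U) i i by apply/CrealP/ger0_real.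
    have {}xR : (U^t* *m M^t* *m U) i i = (U^t* *m M *m U) i i.
      have -> : U^t* *m M^t* *m U = (U^t* *m M *m U)^t* by rewrite !adjmxM trmxCK mulmxA.
      by rewrite -[RHS]xR mxE mxE.
    by rewrite -scalemxAr -scalemxAl mulmxBr mulmxBl
      mxE [X in _ * X]mxE [X in _ + X]mxE xR subrr mulr0.
  rewrite -e eN !mulmxA U1 mul1mx -mulmxA U1 mulmx1.
  by rewrite !mxE eqxx mulr1n.
have N0 : N = 0.
  rewrite eN (_ : rdiag_mx d = 0) ?mulmx0 ?mul0mx //.
  by apply/matrixP => i j; rewrite !mxE d0 mul0rn.
move: N0; rewrite /N => /eqP; rewrite scaler_eq0 (negPf (neq0Ci _)) /= subr_eq0.
by move/eqP=> <-.
Qed.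

Lemma psd_rdiag (n : nat) (d : 'I_n -> R) : (forall i, 0 <= d i) -> psd (rdiag_mx d).
Proof.
move=> d0.
pose s i := Num.sqrt (d i); have -> : rdiag_mx d = rdiag_mx s *m (rdiag_mx s)^t*.
  rewrite adj_rdiag_mx mul_rdiag_mx; congr diag_mx; apply/rowP => i.
  by rewrite !mxE -expr2 sqr_sqrtr.
exact: psd_gram.
Qed.

Lemma psd_eigen (n : nat) (M : 'M[C]_n) : psd M ->
  exists (U : 'M[C]_n) (d : 'I_n -> R),
    [/\ U^t* *m U = 1%:M, U *m U^t* = 1%:M, M = U *m rdiag_mx d *m U^t* &
        forall i, 0 <= d i].
Proof.
move=> pM; have [U [d [U1 U2 eM]]] := hermitian_eigen (psd_herm pM).
exists U, d; split=> // i.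
have := psd_diag_ge0 i (psd_conj (U^t*) pM).
by rewrite eM trmxCK !mulmxA U1 mul1mx -mulmxA U1 mulmx1 !mxE eqxx mulr1n ler0c.
Qed.

(** The columns of [X] are orthogonal eigenvectors of [M] whose squared lengths are the eigenvalues,
    so the Gram matrix of [X] displays the spectrum on its diagonal. *)
Lemma psd_orthogonal_factor (n : nat) (M : 'M[C]_n) : psd M ->
  exists (X : 'M[C]_n) (d : 'I_n -> R), M = X *m X^t* /\ X^t* *m X = rdiag_mx d.
Proof.
move=> /psd_eigen[U [d [U1 _ -> d0]]].
pose s i := Num.sqrt (d i).
have ss : rdiag_mx s *m rdiag_mx s = rdiag_mx d.
  rewrite mul_rdiag_mx; congr diag_mx; apply/rowP => i.
  by rewrite !mxE -expr2 sqr_sqrtr.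
exists (U *m rdiag_mx s), d; rewrite adjmxM adj_rdiag_mx !mulmxA; split.
  by rewrite -[U *m _ *m rdiag_mx s]mulmxA ss.
by rewrite -[_ *m _ *m U]mulmxA U1 mulmx1 ss.
Qed.

Lemma psd_factor (n : nat) (M : 'M[C]_n) : psd M -> exists X : 'M[C]_n, M = X *m X^t*.
Proof. by move=> /psd_orthogonal_factor[X [d [-> _]]]; exists X. Qed.

End Psd.

(** * Entropy *)

Section Entropy.
Variable R : realType.
Local Notation C := R[i].

(** A trace with values in [R]; on positive operators the trace is already real. *)
Definition rtr (n : nat) (M : 'M[C]_n) : R := complex.Re (\tr M).

Lemma rtrE (n : nat) (M : 'M[C]_n) : rtr M = \sum_i complex.Re (M i i).
Proof. exact: Re_sum. Qed.

Lemma rtrD (n : nat) (A B : 'M[C]_n) : rtr (A + B) = rtr A + rtr B.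
Proof. by rewrite /rtr mxtraceD ReD. Qed.

Lemma rtrZ (n : nat) (x : R) (A : 'M[C]_n) : rtr (x%:C *: A) = x * rtr A.
Proof. by rewrite /rtr mxtraceZ ReZ. Qed.

Lemma rtr_mulC (m n : nat) (A : 'M[C]_(m, n)) (B : 'M[C]_(n, m)) : rtr (A *m B) = rtr (B *m A).
Proof. by rewrite /rtr mxtrace_mulC. Qed.

Lemma rtr_ge0 (n : nat) (M : 'M[C]_n) : psd M -> 0 <= rtr M.
Proof. by move=> pM; apply/Re_ge0/psd_tr_ge0. Qed.

Lemma rtr_rdiag (n : nat) (d : 'I_n -> R) : rtr (rdiag_mx d) = \sum_i d i.
Proof. by rewrite rtrE; apply: eq_bigr => i _; rewrite !mxE eqxx. Qed.

Lemma entropy_eigen (m n : nat) (M : 'M[C]_m) (X : 'M[C]_(m, n)) (d : 'I_n -> R) :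
  X^t* *m X = 1%:M -> M = X *m rdiag_mx d *m X^t* -> entropy M = \sum_i eta (d i).
Proof. by move=> X1 eM; apply: (spectral_sum_eigen (eta0 R) X1 eM). Qed.

Lemma entropy_rdiag (n : nat) (d : 'I_n -> R) : entropy (rdiag_mx d) = \sum_i eta (d i).
Proof. by apply: (@entropy_eigen _ _ _ 1%:M); rewrite adjmx1 ?mulmx1 ?mul1mx. Qed.

Lemma entropy_mulmx_adj (m n : nat) (X : 'M[C]_(m, n)) :
  entropy (X *m X^t*) = entropy (X^t* *m X).
Proof. exact/spectral_sum_mulmx_adj/eta0. Qed.

Lemma entropy_tr (n : nat) (M : 'M[C]_n) : M^t* = M -> entropy M^T = entropy M.
Proof. exact/spectral_sum_tr/eta0. Qed.

Lemma entropyZ (n : nat) (c : R) (M : 'M[C]_n) : 0 <= c -> psd M ->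
  entropy (c%:C *: M) = c * entropy M + rtr M * eta c.
Proof.
move=> c0 /psd_eigen[U [d [U1 U2 eM d0]]].
have -> : rtr M = \sum_i d i.
  by rewrite -rtr_rdiag eM -mulmxA rtr_mulC -mulmxA U1 mulmx1.
rewrite (entropy_eigen U1 eM) mulr_sumr mulr_suml -big_split /=.
rewrite (@entropy_eigen _ _ _ U (fun i => c * d i) U1).
  by apply: eq_bigr => i _; rewrite etaM.
rewrite eM scalemxAl scalemxAr; congr (_ *m _ *m _).
by apply/matrixP => i j; rewrite !mxE rmorphM mulrnAr.
Qed.

(* The diagonal of rho in any basis is the image of its spectrum under a doubly
   stochastic matrix, and eta is concave. *)
Lemma entropy_le_diag (n : nat) (M W : 'M[C]_n) : psd M -> W^t* *m W = 1%:M ->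
  entropy M <= \sum_j eta (complex.Re ((W^t* *m M *m W) j j)).
Proof.
move=> /psd_eigen[U [d [U1 U2 eM d0]]] W1.
rewrite (entropy_eigen U1 eM).
have W2 := mulmx1C W1.
have [V eV] : exists V, V = W^t* *m U by eexists.
have V1 : V *m V^t* = 1%:M by rewrite eV adjmxM trmxCK mulmxA -[_ *m U *m _]mulmxA U2 mulmx1.
have V2 := mulmx1C V1.
pose w j i := complex.Re (V j i * Num.conj (V j i)).
have w0 j i : 0 <= w j i by apply/Re_ge0/mul_conjC_ge0.
have wr j : \sum_i w j i = 1.
  rewrite -Re_sum -[RHS]/(complex.Re (1 : C)); congr complex.Re.
  have := congr1 (fun A : 'M_n => A j j) V1; rewrite !mxE eqxx mulr1n => <-.
  by apply: eq_bigr => i _; rewrite !mxE.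
have wc i : \sum_j w j i = 1.
  rewrite -Re_sum -[RHS]/(complex.Re (1 : C)); congr complex.Re.
  have := congr1 (fun A : 'M_n => A i i) V2; rewrite !mxE eqxx mulr1n => <-.
  by apply: eq_bigr => j _; rewrite !mxE mulrC.
have diagE j : complex.Re ((W^t* *m M *m W) j j) = \sum_i w j i * d i.
  have -> : W^t* *m M *m W = V *m rdiag_mx d *m V^t*.
    by rewrite eM eV adjmxM trmxCK !mulmxA.
  rewrite mxE Re_sum; apply: eq_bigr => i _.
  by rewrite mul_mx_diag !mxE [RHS]mulrC -ReZ mulrAC mulrC.
apply: (@le_trans _ _ (\sum_j \sum_i w j i * eta (d i))).
  rewrite exchange_big /=; apply: ler_sum => i _.
  by rewrite -mulr_suml wc mul1r.
by apply: ler_sum => j _; rewrite diagE; apply: eta_jensen.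
Qed.

(** In an eigenbasis [W] of [A + B] the diagonals of [A] and [B] add up to its eigenvalues.
    Replacing [A] and [B] by these diagonals can only raise their entropies, and the scalar defects
    that remain sum to at most the mixing entropy of the traces. *)
Lemma entropyD_ge (n : nat) (A B : 'M[C]_n) : psd A -> psd B ->
  entropy A + entropy B - mixing_entropy (rtr A) (rtr B) <= entropy (A + B).
Proof.
move=> pA pB; have [W [d [W1 W2 eM d0]]] := psd_eigen (psdD pA pB).
pose a j := complex.Re ((W^t* *m A *m W) j j).
have leA : entropy A <= \sum_j eta (a j) := entropy_le_diag pA W1.
pose b j := complex.Re ((W^t* *m B *m W) j j).
have leB : entropy B <= \sum_j eta (b j) := entropy_le_diag pB W1.
have a0 j : 0 <= a j.
  by apply/Re_ge0/psd_diag_ge0; rewrite -[X in _ *m X]trmxCK; apply: psd_conj.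
have b0 j : 0 <= b j.
  by apply/Re_ge0/psd_diag_ge0; rewrite -[X in _ *m X]trmxCK; apply: psd_conj.
have ta : rtr A = \sum_j a j by rewrite -rtrE -mulmxA rtr_mulC -mulmxA W2 mulmx1.
have tb : rtr B = \sum_j b j by rewrite -rtrE -mulmxA rtr_mulC -mulmxA W2 mulmx1.
have dE j : d j = a j + b j.
  have e : W^t* *m (A + B) *m W = rdiag_mx d.
    by rewrite eM !mulmxA W1 mul1mx -mulmxA W1 mulmx1.
  have := congr1 (fun X : 'M_n => complex.Re (X j j)) e.
  rewrite mulmxDr mulmxDl mxE ReD -/(a j) -/(b j) => ->.
  by rewrite !mxE eqxx.
rewrite (entropy_eigen W1 eM)
  (eq_bigr (fun j => eta (a j) + eta (b j) - mixing_entropy (a j) (b j))).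
  rewrite !big_split /= [\sum_i - mixing_entropy _ _]sumrN ta tb.
  exact: lerB (lerD leA leB) (sum_mixing_entropy_le a0 b0).
by move=> j _; rewrite dE /mixing_entropy subKr.
Qed.

(* A = X X^* and B = Y Y^*, so A + B has the nonzero spectrum of the Gram matrix of
   (X Y), whose diagonal lists the eigenvalues of A and of B. *)
Lemma entropyD_le (n : nat) (A B : 'M[C]_n) : psd A -> psd B ->
  entropy (A + B) <= entropy A + entropy B.
Proof.
move=> /psd_orthogonal_factor[X [a [-> eX]]] /psd_orthogonal_factor[Y [b [-> eY]]].
rewrite !entropy_mulmx_adj eX eY !entropy_rdiag.
pose Z := row_mx X Y.
have eZ : Z^t* = col_mx (X^t*) (Y^t*) by rewrite tr_row_mx map_col_mx.
have -> : X *m X^t* + Y *m Y^t* = Z *m Z^t* by rewrite eZ mul_row_col.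
rewrite entropy_mulmx_adj.
have pZ : psd (Z^t* *m Z) by rewrite -[X in _ *m X]trmxCK; apply: psd_gram.
have := @entropy_le_diag _ _ 1%:M pZ; rewrite adjmx1 !mulmx1 mul1mx => /(_ erefl).
move/le_trans; apply; rewrite big_split_ord /= eZ mul_col_row eX eY.
by apply: eq_ler; congr (_ + _); apply: eq_bigr => i _;
   rewrite ?block_mxEul ?block_mxEdr !mxE eqxx.
Qed.

End Entropy.

(** * Partial traces and conditional entropy *)

Section Tensor.
Variable R : realType.
Local Notation C := R[i].

Lemma sum_mxtens (V : nmodType) (m n : nat) (F : 'I_(m * n) -> V) :
  \sum_k F k = \sum_i \sum_j F (mxtens_index (i, j)).
Proof.
rewrite pair_bigA /= (reindex (@mxtens_index m n)) /=.
  by apply: eq_bigr => -[].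
by exists (@mxtens_unindex m n) => ? _; rewrite (mxtens_indexK, mxtens_unindexK).
Qed.

Lemma matrix_tensP (T : Type) (m n p q : nat) (A B : 'M[T]_(m * n, p * q)) :
  (forall i j k l, A (mxtens_index (i, j)) (mxtens_index (k, l)) =
                   B (mxtens_index (i, j)) (mxtens_index (k, l))) -> A = B.
Proof.
move=> AB; apply/matrixP => x y.
by case: (mxtens_indexP x) (mxtens_indexP y) => i j [k l].
Qed.

Lemma adj_tensmx (m n p q : nat) (A : 'M[C]_(m, n)) (B : 'M[C]_(p, q)) :
  (A *t B)^t* = A^t* *t B^t*.
Proof. by rewrite trmx_tens map_mxT. Qed.

Lemma tens1mx1 (m n : nat) : (1%:M : 'M[C]_m) *t (1%:M : 'M[C]_n) = 1%:M.
Proof.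
apply: matrix_tensP => i j k l; rewrite tensmxE !mxE -natrM mulnb.
by rewrite (can_eq (@mxtens_indexK m n)) xpair_eqE.
Qed.

Lemma psd_mxsub (m n : nat) (f : 'I_m -> 'I_n) (M : 'M[C]_n) : psd M -> psd (mxsub f f M).
Proof.
suff -> : mxsub f f M = rowsub f 1%:M *m M *m (rowsub f 1%:M)^t* by exact: psd_conj.
rewrite -rowsubE trmx_mxsub map_mxsub trmx1 map_mx1.
by rewrite mulmx_colsub mulmx1; apply/matrixP => i j; rewrite !mxE.
Qed.

Lemma psd_ptrace1 (m n : nat) (M : 'M[C]_(m * n)) : psd M -> psd (ptrace1 M).
Proof.
move=> pM.
suff -> : ptrace1 M = \sum_k mxsub (fun i => mxtens_index (k, i)) (fun i => mxtens_index (k, i)) M.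
  by apply: psd_sum => k; apply: psd_mxsub.
by apply/matrixP => i j; rewrite summxE !mxE; apply: eq_bigr => k _; rewrite mxE.
Qed.

Lemma psd_ptrace2 (m n : nat) (M : 'M[C]_(m * n)) : psd M -> psd (ptrace2 M).
Proof.
move=> pM.
suff -> : ptrace2 M = \sum_k mxsub (fun i => mxtens_index (i, k)) (fun i => mxtens_index (i, k)) M.
  by apply: psd_sum => k; apply: psd_mxsub.
by apply/matrixP => i j; rewrite summxE !mxE; apply: eq_bigr => k _; rewrite mxE.
Qed.

Lemma tr_ptrace1 (m n : nat) (M : 'M[C]_(m * n)) : \tr (ptrace1 M) = \tr M.
Proof.
rewrite /mxtrace sum_mxtens exchange_big /=.
by apply: eq_bigr => i _; rewrite mxE.
Qed.

Lemma rtr_ptrace1 (m n : nat) (M : 'M[C]_(m * n)) : rtr (ptrace1 M) = rtr M.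
Proof. by rewrite /rtr tr_ptrace1. Qed.

Lemma tr_ptrace2 (m n : nat) (M : 'M[C]_(m * n)) : \tr (ptrace2 M) = \tr M.
Proof. by rewrite /mxtrace sum_mxtens; apply: eq_bigr => i _; rewrite mxE. Qed.

Lemma ptrace1D (m n : nat) (A B : 'M[C]_(m * n)) : ptrace1 (A + B) = ptrace1 A + ptrace1 B.
Proof.
by apply/matrixP => i j; rewrite !mxE -big_split; apply: eq_bigr => k _; rewrite mxE.
Qed.

Lemma ptrace1Z (m n : nat) (x : C) (A : 'M[C]_(m * n)) : ptrace1 (x *: A) = x *: ptrace1 A.
Proof.
by apply/matrixP => i j; rewrite !mxE mulr_sumr; apply: eq_bigr => k _; rewrite mxE.
Qed.

Lemma ptrace1_conj (m n p : nat) (M : 'M[C]_(m * n)) (A : 'M[C]_(p, n)) (B : 'M[C]_(n, p)) :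
  ptrace1 ((1%:M *t A) *m M *m (1%:M *t B)) = A *m ptrace1 M *m B.
Proof.
apply/matrixP => i j; rewrite !mxE.
under eq_bigr => k _.
  rewrite mxE sum_mxtens (bigD1 k) //= [X in _ + X]big1 ?addr0; last first.
    move=> l lk; rewrite big1 // => q _.
    by rewrite [X in _ * X]tensmxE [X in _ * (X * _)]mxE (negPf lk) mul0r mulr0.
  under eq_bigr => q _.
    rewrite [X in _ * X]tensmxE [X in _ * (X * _)]mxE eqxx mul1r.
    rewrite mxE sum_mxtens (bigD1 k) //= [X in _ + X]big1 ?addr0; last first.
      move=> l lk; rewrite big1 // => s _.
      by rewrite tensmxE mxE eq_sym (negPf lk) !mul0r.
    under eq_bigr => s _ do rewrite tensmxE mxE eqxx mul1r.
    over.
  over.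
rewrite exchange_big /=; apply: eq_bigr => q _; rewrite mxE -mulr_suml; congr (_ * _).
rewrite exchange_big /=; apply: eq_bigr => s _; rewrite mxE mulr_sumr.
by apply: eq_bigr.
Qed.

(** [M] is read in the product of the standard basis with an eigenbasis of its marginal. The
    diagonal entries with second index [j] sum to the eigenvalue [d j], and splitting [d j] into [m]
    parts adds at most [d j * log2 m] of entropy. *)
Lemma entropy_le_ptrace1 (m n : nat) (M : 'M[C]_(m * n)) : psd M ->
  entropy M <= entropy (ptrace1 M) + log2 m%:R * rtr M.
Proof.
move=> pM; have [U [d [U1 U2 eM d0]]] := psd_eigen (psd_ptrace1 pM).
pose W : 'M[C]_(m * n) := 1%:M *t U.
have eW : W^t* = 1%:M *t U^t* by rewrite adj_tensmx adjmx1.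
have W1 : W^t* *m W = 1%:M by rewrite eW tensmx_mul U1 mulmx1 tens1mx1.
have W2 := mulmx1C W1.
apply: le_trans (entropy_le_diag pM W1) _.
pose p k := complex.Re ((W^t* *m M *m W) k k).
have p0 k : 0 <= p k.
  by apply/Re_ge0/psd_diag_ge0; rewrite -[X in _ *m X]trmxCK; apply: psd_conj.
have dE j : \sum_i p (mxtens_index (i, j)) = d j.
  transitivity (complex.Re (ptrace1 (W^t* *m M *m W) j j)); first by rewrite mxE Re_sum.
  by rewrite eW ptrace1_conj eM !mulmxA U1 mul1mx -mulmxA U1 mulmx1 !mxE eqxx.
have -> : rtr M = \sum_j d j.
  by rewrite -rtr_ptrace1 eM -rtr_rdiag -mulmxA rtr_mulC -mulmxA U1 mulmx1.
rewrite (entropy_eigen U1 eM) mulr_sumr -big_split /= sum_mxtens exchange_big /=.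
apply: ler_sum => j _; rewrite -dE [log2 _ * _]mulrC.
by apply: (@sum_eta_le R m (fun i => p (mxtens_index (i, j)))).
Qed.

(* Writing M = X X^*, the partial trace is N N^* with N the rearrangement of X, and the
   partial trace of N^* N is X^* X: the complementary state. *)
Lemma entropy_ptrace1_le (m n : nat) (M : 'M[C]_(m * n)) : psd M ->
  entropy (ptrace1 M) <= entropy M + log2 m%:R * rtr M.
Proof.
move=> /psd_factor[X ->].
pose N : 'M[C]_(n, m * (m * n)) :=
  \matrix_(k, l) X (mxtens_index ((mxtens_unindex l).1, k)) (mxtens_unindex l).2.
have eN : ptrace1 (X *m X^t*) = N *m N^t*.
  apply/matrixP => i j; rewrite !mxE sum_mxtens; apply: eq_bigr => k _.
  by rewrite mxE; apply: eq_bigr => l _; rewrite !mxE !mxtens_indexK.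
have eX : ptrace1 (N^t* *m N) = X^t* *m X.
  apply/matrixP => i j; rewrite !mxE sum_mxtens; apply: eq_bigr => k _.
  by rewrite mxE; apply: eq_bigr => l _; rewrite !mxE !mxtens_indexK.
have -> : rtr (X *m X^t*) = rtr (N^t* *m N) by rewrite rtr_mulC -eX rtr_ptrace1.
rewrite eN !entropy_mulmx_adj -eX; apply: entropy_le_ptrace1.
by rewrite -[X in _ *m X]trmxCK; apply: psd_gram.
Qed.

(** The functional f of the overview: the entropy of the first factor conditional on the second, for
    operators of any trace. *)
Definition cond_entropy (m n : nat) (M : 'M[C]_(m * n)) : R := entropy M - entropy (ptrace1 M).

Lemma cond_entropyZ (m n : nat) (c : R) (M : 'M[C]_(m * n)) : 0 <= c -> psd M ->
  cond_entropy (c%:C *: M) = c * cond_entropy M.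
Proof.
move=> c0 pM; rewrite /cond_entropy ptrace1Z !entropyZ //; last exact: psd_ptrace1.
by rewrite rtr_ptrace1; ring.
Qed.

Lemma cond_entropy_bound (m n : nat) (M : 'M[C]_(m * n)) : psd M ->
  `|cond_entropy M| <= log2 m%:R * rtr M.
Proof.
move=> pM; have := entropy_le_ptrace1 pM; have := entropy_ptrace1_le pM.
by rewrite /cond_entropy ler_norml; lra.
Qed.

(** The partial trace preserves traces, so the defects of both entropies lie in the same interval of
    length [mixing_entropy (rtr A) (rtr B)], and so their difference is at most that length. *)
Lemma cond_entropyD (m n : nat) (A B : 'M[C]_(m * n)) : psd A -> psd B ->
  `|cond_entropy (A + B) - (cond_entropy A + cond_entropy B)|
    <= mixing_entropy (rtr A) (rtr B).
Proof.
move=> pA pB; have qA := psd_ptrace1 pA; have qB := psd_ptrace1 pB.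
have := entropyD_ge pA pB; have := entropyD_le pA pB.
have := entropyD_ge qA qB; have := entropyD_le qA qB.
by rewrite /cond_entropy ptrace1D ler_norml !rtr_ptrace1; lra.
Qed.

End Tensor.

(** * Block-diagonal operators *)

Section BlockDiagonal.
Variable R : realType.
Local Notation C := R[i].

(** A quantum system with a classical register: conditional on the value [i] of the register, the
    unnormalised state is [F i]. *)
Definition block_diag (n m : nat) (F : 'I_n -> 'M[C]_m) : 'M[C]_(n * m) :=
  \matrix_(i, j) (F (mxtens_unindex i).1 (mxtens_unindex i).2 (mxtens_unindex j).2
                    *+ ((mxtens_unindex i).1 == (mxtens_unindex j).1)).

Lemma block_diagE (n m : nat) (F : 'I_n -> 'M[C]_m) i k j l :
  block_diag F (mxtens_index (i, k)) (mxtens_index (j, l)) = F i k l *+ (i == j).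
Proof. by rewrite mxE !mxtens_indexK. Qed.

Lemma eq_block_diag (n m : nat) (F G : 'I_n -> 'M[C]_m) :
  F =1 G -> block_diag F = block_diag G.
Proof. by move=> FG; apply/matrixP => i j; rewrite !mxE FG. Qed.

Lemma block_diag_sum (n m : nat) (F : 'I_n -> 'M[C]_m) :
  block_diag F = \sum_i delta_mx i i *t F i.
Proof.
apply: matrix_tensP => i k j l; rewrite block_diagE summxE (bigD1 i) //= big1.
  by rewrite tensmxE mxE eqxx addr0 /= eq_sym mulr_natl.
by move=> s si; rewrite tensmxE mxE eq_sym (negPf si) mul0r.
Qed.

Lemma mul_block_diag (n m : nat) (F G : 'I_n -> 'M[C]_m) :
  block_diag F *m block_diag G = block_diag (fun i => F i *m G i).
Proof.
apply: matrix_tensP => i k j l; rewrite mxE block_diagE sum_mxtens (bigD1 i) //=.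
rewrite [X in _ + X]big1 ?addr0.
  rewrite mxE -sumrMnl; apply: eq_bigr => s _.
  by rewrite !block_diagE eqxx mulr1n mulrnAr.
by move=> s si; rewrite big1 // => t _; rewrite block_diagE eq_sym (negPf si) mulr0n mul0r.
Qed.

Lemma adj_block_diag (n m : nat) (F : 'I_n -> 'M[C]_m) :
  (block_diag F)^t* = block_diag (fun i => (F i)^t*).
Proof.
apply: matrix_tensP => i k j l; rewrite block_diagE mxE mxE block_diagE eq_sym !mxE rmorphMn /=.
by case: eqP => [->|].
Qed.

Lemma block_diag1 (n m : nat) : block_diag (fun _ : 'I_n => 1%:M : 'M[C]_m) = 1%:M.
Proof.
apply: matrix_tensP => i k j l; rewrite block_diagE -tens1mx1 tensmxE !mxE.
by rewrite -mulrnA -natrM mulnC.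
Qed.

Lemma psd_block_diag (n m : nat) (F : 'I_n -> 'M[C]_m) :
  (forall i, psd (F i)) -> psd (block_diag F).
Proof.
move=> pF; have /choice[X eX] i := psd_factor (pF i).
suff -> : block_diag F = block_diag X *m (block_diag X)^t* by exact: psd_gram.
by rewrite adj_block_diag mul_block_diag; apply: eq_block_diag.
Qed.

Lemma entropy_block_diag (n m : nat) (F : 'I_n -> 'M[C]_m) :
  (forall i, psd (F i)) -> entropy (block_diag F) = \sum_i entropy (F i).
Proof.
move=> pF.
have /choice[U eU] i : exists U : 'M[C]_m, exists d,
    U^t* *m U = 1%:M /\ F i = U *m rdiag_mx d *m U^t*.
  by have [U [d [U1 _ eF _]]] := psd_eigen (pF i); exists U, d.
have {eU}/choice[d eU] i := eU i.
pose D k := d (mxtens_unindex k).1 (mxtens_unindex k).2.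
have eD : rdiag_mx D = block_diag (fun i => rdiag_mx (d i)).
  apply: matrix_tensP => i k j l; rewrite block_diagE !mxE /D mxtens_indexK /=.
  by rewrite (can_eq (@mxtens_indexK n m)) xpair_eqE andbC -mulrnA mulnb.
rewrite (@entropy_eigen _ _ _ (block_diag F) (block_diag U) D).
- rewrite sum_mxtens; apply: eq_bigr => i _; have [U1 eF] := eU i.
  rewrite (entropy_eigen U1 eF).
  by apply: eq_bigr => k _; rewrite /D mxtens_indexK.
- rewrite adj_block_diag mul_block_diag -block_diag1.
  by apply: eq_block_diag => i; have [] := eU i.
- rewrite adj_block_diag eD !mul_block_diag.
  by apply: eq_block_diag => i; have [] := eU i.
Qed.

(** The off-diagonal blocks vanish, and [Phi 0 = 0] keeps them zero. *)
Lemma idtens_block_diag (n m p : nat) (Phi : 'M[C]_m -> 'M[C]_p) (F : 'I_n -> 'M[C]_m) :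
  Phi 0 = 0 -> idtens Phi (block_diag F) = block_diag (fun i => Phi (F i)).
Proof.
move=> Phi0; apply: matrix_tensP => i k j l; rewrite block_diagE mxE !mxtens_indexK /=.
have [<-|ij] := eqVneq i j.
  rewrite mulr1n; congr (Phi _ k l); apply/matrixP => s t.
  by rewrite mxE block_diagE eqxx mulr1n.
rewrite (_ : \matrix_(_, _) _ = 0) ?Phi0 ?mxE //.
by apply/matrixP => s t; rewrite mxE block_diagE (negPf ij) mxE.
Qed.

Lemma ptrace1_block_diag (n m : nat) (F : 'I_n -> 'M[C]_m) :
  ptrace1 (block_diag F) = \sum_i F i.
Proof.
apply/matrixP => i j; rewrite mxE summxE; apply: eq_bigr => k _.
by rewrite block_diagE eqxx.
Qed.

Lemma ptrace2_block_diag (n m : nat) (F : 'I_n -> 'M[C]_m) :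
  ptrace2 (block_diag F) = diag_mx (\row_i \tr (F i)).
Proof.
apply/matrixP => i j; rewrite !mxE -sumrMnl; apply: eq_bigr => k _.
exact: block_diagE.
Qed.

Lemma ptrace1_0 (m n : nat) : ptrace1 (0 : 'M[C]_(m * n)) = 0.
Proof. by apply/matrixP => i j; rewrite !mxE big1 // => k _; rewrite mxE. Qed.

Lemma ptrace2_0 (m n : nat) : ptrace2 (0 : 'M[C]_(m * n)) = 0.
Proof. by apply/matrixP => i j; rewrite !mxE big1 // => k _; rewrite mxE. Qed.

Lemma ptrace1_sum (I : finType) (m n : nat) (F : I -> 'M[C]_(m * n)) :
  ptrace1 (\sum_i F i) = \sum_i ptrace1 (F i).
Proof.
apply/matrixP => i j; rewrite mxE summxE.
under eq_bigr do rewrite summxE.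
by rewrite exchange_big; apply: eq_bigr => s _; rewrite mxE.
Qed.

Lemma ptrace2_sum (I : finType) (m n : nat) (F : I -> 'M[C]_(m * n)) :
  ptrace2 (\sum_i F i) = \sum_i ptrace2 (F i).
Proof.
apply/matrixP => i j; rewrite mxE summxE.
under eq_bigr do rewrite summxE.
by rewrite exchange_big; apply: eq_bigr => s _; rewrite mxE.
Qed.

(** Separates S(XT) - S(T), which sees only the outcome probabilities and will cancel between B and
    E, from the entropies of the conditional states. *)
Lemma cond_mutual_info_block_diag (nT nX m : nat) (G : 'I_nT -> 'I_nX -> 'M[C]_m) :
  (forall t x, psd (G t x)) ->
  cond_mutual_info (block_diag (fun t => block_diag (G t))) =
    entropy (block_diag (fun t => diag_mx (\row_x \tr (G t x))))
    - entropy (diag_mx (\row_t \sum_x \tr (G t x)))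
    + (\sum_t entropy (\sum_x G t x) - \sum_t \sum_x entropy (G t x)).
Proof.
move=> pG; rewrite /cond_mutual_info.
rewrite !idtens_block_diag ?ptrace1_0 ?ptrace2_0 // ptrace2_block_diag.
rewrite (eq_block_diag (fun t => ptrace2_block_diag (G t))).
rewrite (eq_block_diag (fun t => ptrace1_block_diag (G t))).
rewrite (@entropy_block_diag _ _ (fun t => \sum_x G t x)); last by move=> t; apply: psd_sum.
rewrite (@entropy_block_diag _ _ (fun t => block_diag (G t))); last first.
  by move=> t; apply: psd_block_diag.
have -> : \sum_t entropy (block_diag (G t)) = \sum_t \sum_x entropy (G t x).
  by apply: eq_bigr => t _; rewrite entropy_block_diag.
have -> : \row_t \tr (block_diag (G t)) = \row_t \sum_x \tr (G t x).
  apply/rowP => t; rewrite !mxE -tr_ptrace1 ptrace1_block_diag.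
  exact: raddf_sum.
ring.
Qed.

End BlockDiagonal.

(** * The key rate *)

Section KeyRate.
Variable R : realType.
Local Notation C := R[i].

Lemma tensmxZr (m n p q : nat) (c : C) (A : 'M[C]_(m, n)) (B : 'M[C]_(p, q)) :
  A *t (c *: B) = c *: (A *t B).
Proof. by apply/matrixP => i j; rewrite !mxE mulrCA. Qed.

Lemma tensmx_sumr (I : finType) (m n p q : nat) (A : 'M[C]_(m, n)) (F : I -> 'M[C]_(p, q)) :
  A *t (\sum_i F i) = \sum_i A *t F i.
Proof.
apply/matrixP => i j; rewrite mxE !summxE mulr_sumr.
by apply: eq_bigr => k _; rewrite mxE.
Qed.

Lemma tensmxZl (m n p q : nat) (c : C) (A : 'M[C]_(m, n)) (B : 'M[C]_(p, q)) :
  (c *: A) *t B = c *: (A *t B).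
Proof. by apply/matrixP => i j; rewrite !mxE mulrA. Qed.

Lemma tensmx_suml (I : finType) (m n p q : nat) (F : I -> 'M[C]_(m, n)) (B : 'M[C]_(p, q)) :
  (\sum_i F i) *t B = \sum_i F i *t B.
Proof.
apply/matrixP => i j; rewrite mxE !summxE mulr_suml.
by apply: eq_bigr => k _; rewrite mxE.
Qed.

(** The unnormalised state left on the second system when the effect [Q] is observed on the
    first. *)
Definition steered (m n : nat) (M : 'M[C]_(m * n)) (Q : 'M[C]_m) : 'M[C]_n :=
  ptrace1 (M *m (Q *t 1%:M)).

Lemma steeredZ (m n : nat) (M : 'M[C]_(m * n)) (c : C) (Q : 'M[C]_m) :
  steered M (c *: Q) = c *: steered M Q.
Proof. by rewrite /steered tensmxZl -scalemxAr ptrace1Z. Qed.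

Lemma steered_sum (I : finType) (m n : nat) (M : 'M[C]_(m * n)) (Q : I -> 'M[C]_m) :
  steered M (\sum_i Q i) = \sum_i steered M (Q i).
Proof. by rewrite /steered tensmx_suml mulmx_sumr ptrace1_sum. Qed.

Lemma mul_tens1E (m n p q : nat) (A : 'M[C]_(p, m)) (M : 'M[C]_(m * n, q)) i k j :
  ((A *t 1%:M) *m M) (mxtens_index (i, k)) j = \sum_s A i s * M (mxtens_index (s, k)) j.
Proof.
rewrite mxE sum_mxtens; apply: eq_bigr => s _; rewrite (bigD1 k) //= big1.
  by rewrite tensmxE mxE eqxx mulr1 addr0.
by move=> t tk; rewrite tensmxE mxE eq_sym (negPf tk) mulr0 mul0r.
Qed.

Lemma mulr_tens1E (m n p q : nat) (A : 'M[C]_(m, p)) (M : 'M[C]_(q, m * n)) i j k :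
  (M *m (A *t 1%:M)) i (mxtens_index (j, k)) = \sum_s M i (mxtens_index (s, k)) * A s j.
Proof.
rewrite mxE sum_mxtens; apply: eq_bigr => s _; rewrite (bigD1 k) //= big1.
  by rewrite tensmxE mxE eqxx mulr1 addr0.
by move=> t tk; rewrite tensmxE mxE (negPf tk) !mulr0.
Qed.

Lemma ptrace1_cyclic (m n p : nat) (M : 'M[C]_(m * n, p * n)) (A : 'M[C]_(p, m)) :
  ptrace1 (M *m (A *t 1%:M)) = ptrace1 ((A *t 1%:M) *m M).
Proof.
apply/matrixP => i j; rewrite !mxE.
under eq_bigr do rewrite mulr_tens1E.
under [RHS]eq_bigr do rewrite mul_tens1E.
by rewrite exchange_big; apply: eq_bigr => s _; apply: eq_bigr => t _; rewrite mulrC.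
Qed.

(* The unnormalised state of the system left after the Kraus operator X^*. *)
Definition kraus (m n : nat) (X : 'M[C]_m) (M : 'M[C]_(m * n)) : 'M[C]_(m * n) :=
  (X^t* *t 1%:M) *m M *m (X *t 1%:M).

Lemma adj_tens1 (m n p : nat) (X : 'M[C]_(m, n)) :
  (X *t (1%:M : 'M_p))^t* = X^t* *t 1%:M.
Proof. by rewrite adj_tensmx adjmx1. Qed.

Lemma psd_kraus (m n : nat) (X : 'M[C]_m) (M : 'M[C]_(m * n)) : psd M -> psd (kraus X M).
Proof.
by move=> /(psd_conj (X^t* *t 1%:M)); rewrite adj_tens1 trmxCK.
Qed.

Lemma krausD (m n : nat) (X : 'M[C]_m) (A B : 'M[C]_(m * n)) :
  kraus X (A + B) = kraus X A + kraus X B.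
Proof. by rewrite /kraus mulmxDr mulmxDl. Qed.

Lemma krausZ (m n : nat) (X : 'M[C]_m) (c : C) (A : 'M[C]_(m * n)) :
  kraus X (c *: A) = c *: kraus X A.
Proof. by rewrite /kraus -scalemxAr -scalemxAl. Qed.

Lemma rtr_kraus (I : finType) (m n : nat) (X : I -> 'M[C]_m) (M : 'M[C]_(m * n)) :
  \sum_i X i *m (X i)^t* = 1%:M -> \sum_i rtr (kraus (X i) M) = rtr M.
Proof.
move=> X1.
have -> : \sum_i rtr (kraus (X i) M) = \sum_i rtr (M *m (X i *m (X i)^t* *t 1%:M)).
  apply: eq_bigr => i _.
  by rewrite /kraus [LHS]rtr_mulC mulmxA tensmx_mul mulmx1 rtr_mulC.
rewrite /rtr -Re_sum -raddf_sum -mulmx_sumr -tensmx_suml X1 tens1mx1.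
by rewrite mulmx1.
Qed.

(** Trades an effect for a Kraus operator by cyclicity of the partial trace; conjugation keeps
    operators positive and pure states pure. *)
Lemma steered_gram (a n : nat) (M : 'M[C]_(a * n)) (X : 'M[C]_a) :
  steered M (X *m X^t*) = ptrace1 (kraus X M).
Proof.
by rewrite /steered -[1%:M in LHS]mulmx1 -tensmx_mul mulmxA ptrace1_cyclic mulmxA.
Qed.

Lemma psd_steered (a n : nat) (M : 'M[C]_(a * n)) (Q : 'M[C]_a) :
  psd M -> psd Q -> psd (steered M Q).
Proof.
by move=> pM /psd_factor[X ->]; rewrite steered_gram; apply/psd_ptrace1/psd_kraus.
Qed.

(** The channel weight is absorbed into the effect, so each pair of [t] and [x] acts as one outcome
    with effect R(t|x) Q_x. *)
Lemma omega_block_diag (a b e nX nT : nat) (M : 'M[C]_(a * (b * e)))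
    (Q : 'I_nX -> 'M[C]_a) (r : 'I_nT -> 'I_nX -> R) :
  omega M Q r = block_diag (fun t => block_diag (fun x => steered M ((r t x)%:C *: Q x))).
Proof.
rewrite block_diag_sum; apply: eq_bigr => t _.
rewrite block_diag_sum tensmx_sumr; apply: eq_bigr => x _.
by rewrite steeredZ !tensmxZr.
Qed.

(** S(B) - S(E) for an operator on BE. *)
Definition entropy_gap (b e : nat) (H : 'M[C]_(b * e)) : R :=
  entropy (ptrace2 H) - entropy (ptrace1 H).

(** The outcome probabilities are the same whether B or E is traced out, so the classical entropies
    cancel in the difference. Linearity of [steered] merges the outcomes [x] at fixed [t] into one
    coarse-grained effect. *)
Lemma key_rate_entropy_gap (a b e nX nT : nat) (M : 'M[C]_(a * (b * e)))
    (Q : 'I_nX -> 'M[C]_a) (r : 'I_nT -> 'I_nX -> R) :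
  psd M -> (forall x, psd (Q x)) -> (forall t x, 0 <= r t x) ->
  key_rate M Q r =
    \sum_t entropy_gap (steered M (\sum_x (r t x)%:C *: Q x))
    - \sum_t \sum_x entropy_gap (steered M ((r t x)%:C *: Q x)).
Proof.
move=> pM pQ r0; rewrite /key_rate omega_block_diag.
pose H t x := steered M ((r t x)%:C *: Q x).
have pH t x : psd (H t x) by apply/psd_steered/psdZ.
have idtens0 p q (Phi : 'M[C]_p -> 'M[C]_q) k : Phi 0 = 0 -> idtens (m := k) Phi 0 = 0.
  move=> Phi0; apply/matrixP => i j; rewrite !mxE (_ : \matrix_(_, _) _ = 0) ?Phi0 ?mxE //.
  by apply/matrixP => s t; rewrite !mxE.
rewrite !idtens_block_diag ?idtens0 ?ptrace1_0 ?ptrace2_0 //.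
rewrite (eq_block_diag (fun t => idtens_block_diag (H t) (ptrace1_0 _ _ _))).
rewrite (eq_block_diag (fun t => idtens_block_diag (H t) (ptrace2_0 _ _ _))).
rewrite !cond_mutual_info_block_diag; try by move=> t x; apply: psd_ptrace1 || apply: psd_ptrace2.
have tr12 t x : \tr (ptrace2 (H t x)) = \tr (ptrace1 (H t x)) by rewrite tr_ptrace1 tr_ptrace2.
have -> : \row_t \sum_x \tr (ptrace2 (H t x)) = \row_t \sum_x \tr (ptrace1 (H t x)).
  by apply/rowP => t; rewrite !mxE; apply: eq_bigr => x _.
rewrite (eq_block_diag (G := fun t => diag_mx (\row_x \tr (ptrace1 (H t x))))); last first.
  by move=> t; congr diag_mx; apply/rowP => x; rewrite !mxE.
rewrite /entropy_gap sumrB (eq_bigr _ (fun t _ => sumrB _ _ _ _)) sumrB.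
under [X in _ = X - _ - _]eq_bigr do rewrite steered_sum ptrace2_sum.
under [X in _ = _ - X - _]eq_bigr do rewrite steered_sum ptrace1_sum.
rewrite -/(H _ _); ring.
Qed.

(* phi := X^* psi is pure on ABE, so its marginals on E and on AB have the same entropy. *)
Lemma entropy_gap_steered (a b e : nat) (rho : 'M[C]_(a * b)) (M : 'M[C]_(a * (b * e)))
    (X : 'M[C]_a) : purification rho M ->
  entropy_gap (steered M (X *m X^t*)) = - cond_entropy (kraus X rho).
Proof.
move=> [[psi ->] rhoE].
(* The amplitudes of [psi] are rearranged into a matrix from E to AB; tracing out E then becomes a
   product of [Psi] with its adjoint. *)
pose Psi : 'M[C]_(a * b, e) :=
  \matrix_(k, l) psi (mxtens_index ((mxtens_unindex k).1,
                                    mxtens_index ((mxtens_unindex k).2, l))) 0.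
have {rhoE}-> : rho = Psi *m Psi^t*.
  rewrite -rhoE; apply: matrix_tensP => i j k l; rewrite !mxE !mxtens_indexK /=.
  apply: eq_bigr => s _; rewrite !mxE big_ord1 !mxE !mxtens_indexK /=.
  by [].
pose phi := (X^t* *t 1%:M) *m psi.
pose Phi := (X^t* *t 1%:M) *m Psi.
have PhiE i j l : Phi (mxtens_index (i, j)) l = phi (mxtens_index (i, mxtens_index (j, l))) 0.
  by rewrite !mul_tens1E; apply: eq_bigr => s _; congr (_ * _); rewrite mxE !mxtens_indexK.
have eK : kraus X (Psi *m Psi^t*) = Phi *m Phi^t*.
  by rewrite /kraus /Phi adjmxM adj_tens1 trmxCK !mulmxA.
have ek : kraus X (psi *m psi^t*) = phi *m phi^t*.
  by rewrite /kraus /phi adjmxM adj_tens1 trmxCK !mulmxA.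
clearbody phi Phi; rewrite steered_gram eK ek /entropy_gap /cond_entropy.
have -> : ptrace2 (ptrace1 (phi *m phi^t*)) = ptrace1 (Phi *m Phi^t*).
  apply/matrixP => i j; rewrite !mxE.
  under eq_bigr do rewrite mxE.
  rewrite exchange_big; apply: eq_bigr => s _; rewrite mxE; apply: eq_bigr => l _.
  by rewrite mxE big_ord1 !mxE !PhiE.
(* The marginal on E comes out transposed, which does not change its entropy. *)
have -> : ptrace1 (ptrace1 (phi *m phi^t*)) = (Phi^t* *m Phi)^T.
  apply/matrixP => i j; rewrite !mxE sum_mxtens.
  under eq_bigr do rewrite mxE.
  rewrite exchange_big; apply: eq_bigr => s _; apply: eq_bigr => l _.
  by rewrite mxE big_ord1 !mxE !PhiE mulrC.
rewrite entropy_tr; last by rewrite adjmxM trmxCK.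
by rewrite -entropy_mulmx_adj opprB.
Qed.

End KeyRate.

(** * Continuity *)

Section Continuity.
Variable R : realType.
Local Notation C := R[i].

(** [A] is the absolute value of [H], built on its eigenbasis; [A + H] is then twice the positive
    part of [H]. *)
Lemma hermitian_abs (n : nat) (H : 'M[C]_n) : H^t* = H ->
  exists A : 'M[C]_n, [/\ psd A, psd (A + H) & rtr A = trace_norm H].
Proof.
move=> hH; have [U [d [U1 U2 eH]]] := hermitian_eigen hH.
exists (U *m rdiag_mx (fun i => `|d i|) *m U^t*); split.
- by apply/psd_conj/psd_rdiag.
- rewrite eH -mulmxDl -mulmxDr; apply: psd_conj.
  rewrite (_ : _ + _ = rdiag_mx (fun i => `|d i| + d i)).
    by apply: psd_rdiag => i; rewrite -lerBlDr sub0r -normrN ler_norm.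
  by apply/matrixP => i j; rewrite !mxE rmorphD mulrnDl.
rewrite -mulmxA rtr_mulC -mulmxA U1 mulmx1 rtr_rdiag.
rewrite -[RHS]/(spectral_sum (@Num.sqrt R) (H^t* *m H)).
rewrite (@spectral_sum_eigen _ _ _ _ _ U (fun i => d i * d i)) ?sqrtr0 //.
  by apply: eq_bigr => i _; rewrite -expr2 sqrtr_sqr.
by rewrite hH eH -mul_rdiag_mx !mulmxA -[_ *m _ *m U]mulmxA U1 mulmx1.
Qed.

(* The Alicki-Fannes interpolation: with A = |rho - sigma| of trace eps, the state
   (1 - eps) rho + A equals (1 - eps) sigma + B where B >= 0 also has trace eps. *)
Lemma almost_additive_continuity (n : nat) (F : 'M[C]_n -> R) (L : R) (rho sigma : 'M[C]_n) :
  (forall c M, 0 <= c -> psd M -> F (c%:C *: M) = c * F M) ->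
  (forall M, psd M -> `|F M| <= L * rtr M) ->
  (forall A B, psd A -> psd B ->
     `|F (A + B) - (F A + F B)| <= mixing_entropy (rtr A) (rtr B)) ->
  state rho -> state sigma ->
  let eps := trace_norm (rho - sigma) in eps <= 1 ->
  `|F rho - F sigma| <= 4 * eps * L + 2 * eta (1 - eps) + 2 * eta eps.
Proof.
move=> FZ FL FD [prho trho] [psigma tsigma] eps eps1.
have hH : (rho - sigma)^t* = rho - sigma by rewrite adjmxB !psd_herm.
have [A [pA pAH tA]] := hermitian_abs hH; rewrite -/eps in tA.
have eps0 : 0 <= eps by rewrite -tA rtr_ge0.
have eps1' : 0 <= 1 - eps by rewrite subr_ge0.
(* [B] solves (1 - eps) rho + A = (1 - eps) sigma + B, written as a convex combination of positive
   operators to show that it is positive. *)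
pose B := eps%:C *: A + (1 - eps)%:C *: (A + (rho - sigma)).
have pB : psd B by apply: psdD; apply: psdZ.
have rrho : rtr rho = 1 by rewrite /rtr trho.
have rsigma : rtr sigma = 1 by rewrite /rtr tsigma.
have tB : rtr B = eps.
  have rd : rtr (rho - sigma) = 0 by rewrite /rtr raddfB /= trho tsigma subrr.
  by rewrite rtrD !rtrZ rtrD rd tA; ring.
have eAB : (1 - eps)%:C *: rho + A = (1 - eps)%:C *: sigma + B.
  apply/matrixP => i j; rewrite !mxE rmorphB rmorph1; ring.
have pr := psdZ eps1' prho; have ps := psdZ eps1' psigma.
have := FD _ _ pr pA; have := FD _ _ ps pB; rewrite -eAB.
rewrite !FZ // !rtrZ rrho rsigma tA tB mulr1 /mixing_entropy subrK eta1.
have := FL _ pA; have := FL _ pB; have := FL _ prho; have := FL _ psigma.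
rewrite tA tB rrho rsigma mulr1.
set x := F rho; set y := F sigma; set u := F A; set v := F B; set w := F _.
rewrite !ler_norml => /andP[y1 y2] /andP[x1 x2] /andP[v1 v2] /andP[u1 u2] /andP[h1 h2] /andP[k1 k2].
(* Near-additivity at the common operator bounds (1 - eps)(x - y) by v - u plus two mixing
   entropies, and v - u by 2 eps L. The missing part eps (x - y) costs another 2 eps L. *)
have xy1 : eps * (x - y) <= eps * (2 * L) by apply: ler_wpM2l => //; lra.
have xy2 : eps * (y - x) <= eps * (2 * L) by apply: ler_wpM2l => //; lra.
by lra.
Qed.

(** The functional F of the overview, for the Kraus operators adjoint to the [X i]. *)
Definition kraus_cond_entropy (I : finType) (a b : nat) (X : I -> 'M[C]_a)
    (M : 'M[C]_(a * b)) : R :=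
  \sum_i cond_entropy (kraus (X i) M).

Section Kraus.
Variables (I : finType) (a b : nat) (X : I -> 'M[C]_a).
Hypothesis X1 : \sum_i X i *m (X i)^t* = 1%:M.
Local Notation F := (@kraus_cond_entropy I a b X).

Lemma kraus_cond_entropyZ c M : 0 <= c -> psd M -> F (c%:C *: M) = c * F M.
Proof.
move=> c0 pM; rewrite /kraus_cond_entropy mulr_sumr; apply: eq_bigr => i _.
by rewrite krausZ cond_entropyZ //; apply: psd_kraus.
Qed.

Lemma kraus_cond_entropy_bound M : psd M -> `|F M| <= log2 a%:R * rtr M.
Proof.
move=> pM; rewrite -(rtr_kraus M X1) mulr_sumr.
apply: le_trans (ler_norm_sum _ _ _) _; apply: ler_sum => i _.
exact/cond_entropy_bound/psd_kraus.
Qed.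

(** Concavity of the mixing entropy lets the defects of all outcomes add up to no more than that of
    the total traces, so the number of outcomes does not enter. *)
Lemma kraus_cond_entropyD A B : psd A -> psd B ->
  `|F (A + B) - (F A + F B)| <= mixing_entropy (rtr A) (rtr B).
Proof.
move=> pA pB; rewrite -(rtr_kraus A X1) -(rtr_kraus B X1).
have pK (M : 'M_(a * b)) i : psd M -> psd (kraus (X i) M) by exact: psd_kraus.
pose f (M : 'M_(a * b)) i := cond_entropy (kraus (X i) M).
have -> : F (A + B) - (F A + F B) = \sum_i (f (A + B) i - (f A i + f B i)).
  by rewrite sumrB [\sum_i (f A i + f B i)]big_split.
apply: le_trans (ler_norm_sum _ _ _) _.
apply: (@le_trans _ _ (\sum_i mixing_entropy (rtr (kraus (X i) A)) (rtr (kraus (X i) B)))).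
  by apply: ler_sum => i _; rewrite /f krausD; apply: cond_entropyD; apply: pK.
by apply: sum_mixing_entropy_le => i; apply/rtr_ge0/pK.
Qed.

Lemma kraus_cond_entropy_continuity rho sigma : state rho -> state sigma ->
  let eps := trace_norm (rho - sigma) in eps <= 1 ->
  `|F rho - F sigma| <= 4 * eps * log2 a%:R + 2 * eta (1 - eps) + 2 * eta eps.
Proof.
apply: almost_additive_continuity.
- exact: kraus_cond_entropyZ.
- exact: kraus_cond_entropy_bound.
- exact: kraus_cond_entropyD.
Qed.

End Kraus.

(** [Y] factors the coarse-grained effects and [Z] the effects R(t|x) Q_x. Both are chosen before
    [e], [rho] and [M], so the same two functionals serve two states with different purifying
    systems. *)
Lemma key_rate_kraus (a b nX nT : nat) (Q : 'I_nX -> 'M[C]_a) (r : 'I_nT -> 'I_nX -> R) :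
  povm Q -> channel r ->
  exists (Y : 'I_nT -> 'M[C]_a) (Z : 'I_nT * 'I_nX -> 'M[C]_a),
    [/\ \sum_i Y i *m (Y i)^t* = 1%:M, \sum_i Z i *m (Z i)^t* = 1%:M &
        forall e (rho : 'M[C]_(a * b)) (M : 'M[C]_(a * (b * e))), purification rho M ->
          key_rate M Q r = kraus_cond_entropy Z rho - kraus_cond_entropy Y rho].
Proof.
move=> [pQ Q1] [r0 r1].
have pY t : psd (\sum_x (r t x)%:C *: Q x) by apply: psd_sum => x; apply: psdZ.
have pZ (i : 'I_nT * 'I_nX) : psd ((r i.1 i.2)%:C *: Q i.2) by apply: psdZ.
have /choice[Y eY] t := psd_factor (pY t).
have /choice[Z eZ] i := psd_factor (pZ i).
have sumQ : \sum_t \sum_x (r t x)%:C *: Q x = 1%:M.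
  rewrite exchange_big -Q1; apply: eq_bigr => x _.
  by rewrite -scaler_suml -rmorph_sum r1 rmorph1 scale1r.
exists Y, Z; split.
- by rewrite -sumQ; apply: eq_bigr => t _; rewrite eY.
- by rewrite -sumQ pair_bigA; apply: eq_bigr => i _; rewrite eZ.
move=> e rho M puri; rewrite key_rate_entropy_gap //; last first.
  by have [[psi ->] _] := puri; apply: psd_gram.
rewrite pair_bigA addrC -sumrN; congr (_ + _).
  by apply: eq_bigr => -[t x] _; rewrite (eZ (t, x)) (entropy_gap_steered _ puri) opprK.
rewrite /kraus_cond_entropy -sumrN.
by apply: eq_bigr => t _; rewrite eY (entropy_gap_steered _ puri).
Qed.

Lemma norm_subB_le (x x' y y' d : R) : `|x - x'| <= d -> `|y - y'| <= d ->
  `|(x - y) - (x' - y')| <= 2 * d.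
Proof. by rewrite !ler_norml; lra. Qed.

(** * Passage to the supremum over measurements and channels *)

Section Supremum.
Variables (a b : nat).

(** A bound uniform in the alphabets, which makes the supremum in [K1] a genuine least upper bound
    and not a default value. *)
Lemma key_rate_bound (e : nat) (rho : 'M[C]_(a * b)) (M : 'M[C]_(a * (b * e))) nX nT
    (Q : 'I_nX -> 'M[C]_a) (r : 'I_nT -> 'I_nX -> R) :
  state rho -> purification rho M -> povm Q -> channel r ->
  key_rate M Q r <= 2 * log2 a%:R.
Proof.
move=> [prho trho] puri povmQ chr.
have [Y [Z [Y1 Z1 /(_ _ _ _ puri)->]]] := key_rate_kraus b povmQ chr.
have := kraus_cond_entropy_bound Y1 prho; have := kraus_cond_entropy_bound Z1 prho.
by rewrite /rtr trho mulr1 !ler_norml; lra.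
Qed.

Lemma K1_le (e e' : nat) (rho' : 'M[C]_(a * b)) (M : 'M[C]_(a * (b * e)))
    (M' : 'M[C]_(a * (b * e'))) (delta : R) :
  state rho' -> purification rho' M' ->
  (forall nX nT (Q : 'I_nX -> 'M[C]_a) (r : 'I_nT -> 'I_nX -> R), povm Q -> channel r ->
     key_rate M Q r <= key_rate M' Q r + delta) ->
  K1 M <= K1 M' + delta.
Proof.
move=> srho' puri' le_key.
apply: ge_sup.
  (* The trivial measurement with the one-letter channel shows that the set of rates is nonempty. *)
  pose Q := fun _ : 'I_1 => 1%:M : 'M[C]_a; pose r := fun _ _ : 'I_1 => 1 : R.
  exists (key_rate M Q r); exists 1%N, 1%N, Q, r; split=> //.
    by split; rewrite ?big_ord1 // => x; apply: psd1.
  by split=> [t x|x]; rewrite ?big_ord1.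
move=> _ [nX [nT [Q [r [povmQ chr ->]]]]].
apply: le_trans (le_key _ _ _ _ povmQ chr) _; rewrite lerD2r.
apply: ub_le_sup; last by exists nX, nT, Q, r.
exists (2 * log2 a%:R) => _ [nX' [nT' [Q' [r' [povmQ' chr' ->]]]]].
exact: key_rate_bound puri' _ _.
Qed.

End Supremum.
End Continuity.

Theorem lemmaV3 (R : realType) (dA dB dE dE' : nat)
    (rho rho' : 'M[R[i]]_(dA * dB))
    (rhoABE : 'M[R[i]]_(dA * (dB * dE)))
    (rhoABE' : 'M[R[i]]_(dA * (dB * dE')))
    (eps : R)
    (Hrho : state rho) (Hrho' : state rho')
    (HrhoABE : purification rho rhoABE)
    (HrhoABE' : purification rho' rhoABE')
    (Heps : eps = trace_norm (rho - rho'))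
    (Heps1 : eps <= 1) :
  `|K1 rhoABE - K1 rhoABE'|
    <= 8 * eps * log2 (dA%:R : R) + 4 * eta (1 - eps) + 4 * eta eps.
Proof.
set delta := (X in _ <= X).
(* The distance is bounded for each fixed strategy, uniformly, so that it survives taking
   suprema. *)
have key_dist nX nT (Q : 'I_nX -> 'M_dA) (r : 'I_nT -> 'I_nX -> R) : povm Q -> channel r ->
    `|key_rate rhoABE Q r - key_rate rhoABE' Q r| <= delta.
  move=> povmQ chr; have [Y [Z [Y1 Z1 keyE]]] := key_rate_kraus dB povmQ chr.
  rewrite (keyE _ _ _ HrhoABE) (keyE _ _ _ HrhoABE'); subst eps.
  (* Half of [delta] is the continuity bound of one functional; the rate is a difference of two. *)
  rewrite (_ : delta = 2 * (4 * trace_norm (rho - rho') * log2 dA%:R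
    + 2 * eta (1 - trace_norm (rho - rho')) + 2 * eta (trace_norm (rho - rho')))).
    by apply: norm_subB_le; apply: kraus_cond_entropy_continuity.
  by rewrite /delta; ring.
have le1 : K1 rhoABE <= K1 rhoABE' + delta.
  apply: (K1_le Hrho' HrhoABE') => nX nT Q r povmQ chr.
  exact/ler_distlDr/key_dist.
have le2 : K1 rhoABE' <= K1 rhoABE + delta.
  apply: (K1_le Hrho HrhoABE) => nX nT Q r povmQ chr.
  exact/ler_distlCDr/key_dist.
by rewrite ler_distl lerBlDr le1 le2.
Qed.
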